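(* Let $q$, $w$ and $d$ be fixed positive integers, where $d$ is odd, and let $t=\frac{2w-d+1}{2}$. Then for sufficiently large integers $n$, $$A_q(n,d,w)\ge (1-o(1))\frac{(q-1)^t\binom{n}{t}}{\binom{w}{t}},$$ where $o(1)\to 0$ as $n\to\infty$.
   Context: Let $\Sigma_q=\{0,1,\dots,q-1\}$. For $\mathbf{x}\in\Sigma_q^n$, the weight $\mathrm{wt}(\mathbf{x})$ is the number of nonzero coordinates, and the Hamming distance $d(\mathbf{x},\mathbf{y})$ is the number of coordinates in which $\mathbf{x},\mathbf{y}$ differ. An $(n,d,w)_q$-constant weight code is a set $C\subseteq\Sigma_q^n$ in which every vector has weight $w$ and any two distinct vectors have Hamming distance at least $d$. $A_q(n,d,w)$ denotes the maximum size of an $(n,d,w)_q$-constant weight code.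
   Formalization: The case q=1, t=0 (d=2w+1) is excluded, since there A_1(n,d,w)=0 while the bound is 1-o(1) with 0^0=1; and t is assumed to be a nonnegative integer (d ≤ 2w+1), since otherwise binom(w,t)=0 stands in the denominator. *)

(* Defs.v *)
From HB Require Import structures.
From mathcomp Require Import all_boot all_order all_algebra.

Set Implicit Arguments.
Unset Strict Implicit.
Unset Printing Implicit Defensive.

Section ConstantWeightCodes.
Variables q n : nat.

(* Sigma_q^n, with Sigma_q = 'I_q. *)
Definition word : finType := {ffun 'I_n -> 'I_q}.

(* The zero letter is tested on the underlying natural number because 'I_q has
   no canonical zero for a variable q. *)
Definition wt (x : word) : nat := #|[set i | x i != 0 :> nat]|.

Definition hdist (x y : word) : nat := #|[set i | x i != y i]|.

Definition cw_code (d w : nat) (C : {set word}) : bool :=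
  [forall x in C, wt x == w] &&
  [forall x in C, forall y in C, (x != y) ==> (d <= hdist x y)].

Definition Aq (d w : nat) : nat := \max_(C : {set word} | cw_code d w C) #|C|.

End ConstantWeightCodes.

(* Main.v *)
(** Take the hypergraph whose vertices are the words of weight [t] together with
    the [(t+1)]-sets of positions, and whose edges are the words [x] of weight
    [w], [x] being incident to its restrictions of weight [t] and to the
    [(t+1)]-subsets of its support. Two disjoint edges agree on fewer than [t]
    nonzero letters and their supports share at most [t] positions, so their
    distance is at least [2w - t - (t - 1) = d], and a matching is a code. The
    hypergraph is uniform, its degrees are at most
    [D = C(n-t, w-t) (q-1)^(w-t)], its codegrees are [o(D)], and the number of
    edges divided by [D] is the bound to be proved.

    It remains to find a matching with [(1 - o(1)) |E| / D] edges (Pippenger).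
    If a fraction [beta < 1] of [|E| / D] can always be achieved, then so can
    [beta + kappa] for some [kappa] bounded below in terms of [1 - beta]: choose
    each edge with probability [theta / D], keep the isolated chosen edges, and
    apply the hypothesis to the edges meeting no chosen one. Padding every
    vertex to degree [D] with dummy edges makes each vertex survive with the
    same probability [s], so that degrees drop to about [s^(k-1) D] (second
    moment) and the number of edges to about [s^k |E|]. Only expectations enter,
    and no error is propagated from one round to the next. *)

Require Import Defs.
From HB Require Import structures.
From mathcomp Require Import all_boot all_order all_algebra.
From mathcomp Require Import zify ring lra.

Set Implicit Arguments.
Unset Strict Implicit.
Unset Printing Implicit Defensive.

Import Order.TTheory GRing.Theory Num.Theory.

Lemma card_bigcup_le (J T : finType) (P : pred J) (F : J -> {set T}) :
  (#|\bigcup_(j | P j) F j| <= \sum_(j | P j) #|F j|)%N.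
Proof.
elim/big_rec2: _ => [|j n A _ An]; first by rewrite cards0.
by apply: leq_trans (leq_card_setU _ _) _; rewrite leq_add2l.
Qed.

(** * Bernoulli random subsets *)

Section RandomSubset.
Local Open Scope ring_scope.
Variables (R : realFieldType) (I : finType) (p : R).
Hypotheses (p_ge0 : 0 <= p) (p_le1 : p <= 1).

Definition bernoulli (S : {set I}) : R := \prod_i (if i \in S then p else 1 - p).

Definition expect (F : {set I} -> R) : R := \sum_S bernoulli S * F S.

Lemma bernoulli_ge0 S : 0 <= bernoulli S.
Proof. by apply: prodr_ge0 => i _; case: ifP; rewrite ?subr_ge0. Qed.

Lemma eq_expect F G : F =1 G -> expect F = expect G.
Proof. by move=> FG; apply: eq_bigr => S _; rewrite FG. Qed.

Lemma expect_le F G : (forall S, F S <= G S) -> expect F <= expect G.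
Proof. by move=> FG; apply: ler_sum => S _; rewrite ler_wpM2l ?bernoulli_ge0. Qed.

Lemma expectD F G : expect (fun S => F S + G S) = expect F + expect G.
Proof. by rewrite -big_split; apply: eq_bigr => S _; rewrite mulrDr. Qed.

Lemma expectZ a F : expect (fun S => a * F S) = a * expect F.
Proof. by rewrite /expect mulr_sumr; apply: eq_bigr => S _; rewrite mulrCA. Qed.

Lemma expect_sum (J : finType) (P : pred J) (F : J -> {set I} -> R) :
  expect (fun S => \sum_(j | P j) F j S) = \sum_(j | P j) expect (F j).
Proof. by rewrite exchange_big; apply: eq_bigr => S _; rewrite mulr_sumr. Qed.

(** Independence of the items, by distributing a product of two-term sums over all subsets. The
    exact probabilities below are instances. *)
Lemma expect_prod (F G : I -> R) :
  expect (fun S => \prod_i (if i \in S then F i else G i))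
  = \prod_i (p * F i + (1 - p) * G i).
Proof.
rewrite bigA_distr; apply: eq_bigr => S _.
by rewrite -big_split; apply: eq_bigr => i _; case: ifP.
Qed.

Lemma prod_natr_bool (b : pred I) : \prod_i (b i)%:R = [forall i, b i]%:R :> R.
Proof.
case: (boolP [forall i, b i]) => [/forallP bT|].
  by rewrite big1 // => i _; rewrite bT.
by rewrite negb_forall => /existsP[i /negPf bi]; rewrite (bigD1 i) //= bi mul0r.
Qed.

Lemma expect_cst a : expect (fun=> a) = a.
Proof.
have := expect_prod (fun=> 1) (fun=> 1); rewrite [RHS]big1 => [E1|i _]; last first.
  by rewrite !mulr1 addrC subrK.
rewrite -[RHS]mulr1 -E1 -expectZ; apply: eq_expect => S.
by rewrite big1 ?mulr1 // => i _; case: ifP.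
Qed.

Lemma expect_avoid (A : {set I}) :
  expect (fun S => [disjoint S & A]%:R) = (1 - p) ^+ #|A|.
Proof.
transitivity (expect (fun S =>
    \prod_i (if i \in S then (i \notin A)%:R else 1))).
  apply: eq_expect => S.
  rewrite (eq_bigr (fun i => ((i \in S) ==> (i \notin A))%:R)) => [|i _]; last first.
    by case: ifP.
  rewrite prod_natr_bool disjoint_subset; congr (_%:R); congr nat_of_bool.
  apply/subsetP/forallP => [SA i|SA i iS]; first by apply/implyP => /SA.
  by have /implyP/(_ iS) := SA i.
rewrite expect_prod -prodr_const (bigID (mem A)) /= [X in _ * X]big1 => [|i ->].
  by rewrite mulr1; apply: eq_bigr => i ->; rewrite mulr0 add0r mulr1.
by rewrite !mulr1 addrC subrK.
Qed.

Lemma expect_single (A : {set I}) e : e \in A ->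
  expect (fun S => (S :&: A == [set e])%:R) = p * (1 - p) ^+ #|A|.-1.
Proof.
move=> eA; transitivity (expect (fun S =>
    \prod_i (if i \in S then ((i \notin A) || (i == e))%:R else (i != e)%:R))).
  apply: eq_expect => S.
  rewrite (eq_bigr (fun i => (((i \in S) && (i \in A)) == (i == e))%:R)) => [|i _].
    rewrite prod_natr_bool; congr (_%:R); congr nat_of_bool.
    apply/eqP/forallP => [SA i|SA]; first by rewrite -in_setI SA inE.
    by apply/setP => i; rewrite !inE; apply/eqP/SA.
  have [->|_] := eqVneq i e; first by rewrite eA andbT orbT; case: (e \in S).
  by case: (i \in S); case: (i \in A).
rewrite expect_prod (bigD1 e) //= eqxx orbT mulr0 addr0 mulr1; congr (_ * _).
rewrite (bigID (mem A)) /= [X in _ * X]big1 => [|i /andP[-> ->]]; last first.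
  by rewrite !mulr1 addrC subrK.
rewrite mulr1 (eq_bigr (fun=> 1 - p)) => [|i /andP[/negPf-> ->]]; last first.
  by rewrite mulr0 add0r mulr1.
rewrite prodr_const (cardD1 e A) eA /=; congr (_ ^+ _).
Qed.

(** By Bernoulli's inequality, a shortfall of [m] in the exponent costs at most [m * p]. This
    absorbs overlaps between stars; with [a = 0] it bounds survival probabilities from below. *)
Lemma expr1B_sub (a b m : nat) : (b <= a + m)%N ->
  (1 - p) ^+ a <= (1 - p) ^+ b + m%:R * p.
Proof.
move=> bam.
have bern j : 1 - j%:R * p <= (1 - p) ^+ j.
  elim: j => [|j IH]; first by rewrite expr0; lra.
  have : 0 <= j%:R * p * p by rewrite !mulr_ge0.
  rewrite exprS -natr1; move: IH p_ge0 p_le1.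
  by move: (j%:R) ((1 - p) ^+ j) => x y IH p0 p1; nra.
have q0 : 0 <= 1 - p by rewrite subr_ge0.
have q1 : 1 - p <= 1 by rewrite gerBl.
have le1 j : (1 - p) ^+ j <= 1 by exact: exprn_ile1.
apply: le_trans (_ : (1 - p) ^+ (a + m) + m%:R * p <= _); last first.
  by rewrite lerD2r ler_wiXn2l.
rewrite exprD; have := bern m; have := le1 a; have := le1 m.
have : 0 <= (1 - p) ^+ a by exact: exprn_ge0.
move: (_ ^+ a) (_ ^+ m) (_ * p) => x y z; nra.
Qed.

End RandomSubset.

(** * One round of the nibble *)

Section Matching.
Variables (V Ed : finType) (inc : Ed -> {set V}).
Implicit Types E M : {set Ed}.

Definition edges_at E v := [set e in E | v \in inc e].

Definition is_matching M :=
  [forall e in M, forall f in M, (e != f) ==> [disjoint inc e & inc f]].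

Definition nu E : nat := \max_(M : {set Ed} | (M \subset E) && is_matching M) #|M|.

Lemma is_matchingP M :
  reflect {in M &, forall e f, e != f -> [disjoint inc e & inc f]} (is_matching M).
Proof.
apply: (iffP forall_inP) => [MP e f eM fM ef|MP e eM].
  by have /forall_inP/(_ f fM)/implyP/(_ ef) := MP e eM.
by apply/forall_inP => f fM; apply/implyP; apply: MP.
Qed.

Lemma nu_ge E M : M \subset E -> is_matching M -> (#|M| <= nu E)%N.
Proof.
move=> ME MM; apply: (@leq_bigmax_cond _ _ (fun M : {set Ed} => #|M|)).
by rewrite ME.
Qed.

Lemma nu_witness E :
  exists M : {set Ed}, [/\ M \subset E, is_matching M & nu E = #|M|].
Proof.
have [|M /andP[ME MM] nuE] := @eq_bigmax_cond _
    [pred M : {set Ed} | (M \subset E) && is_matching M] (fun M : {set Ed} => #|M|).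
  apply/card_gt0P; exists set0; rewrite inE sub0set; apply/is_matchingP.
  by move=> e f; rewrite inE.
by exists M; split.
Qed.

Lemma is_matchingU M N : is_matching M -> is_matching N ->
    {in M & N, forall e f, [disjoint inc e & inc f]} -> is_matching (M :|: N).
Proof.
move=> /is_matchingP MM /is_matchingP NN MN; apply/is_matchingP => e f.
rewrite !inE => /orP[eM|eN] /orP[fM|fN]; [exact: MM| |  |exact: NN] => _.
  exact: MN.
by rewrite disjoint_sym; apply: MN.
Qed.

End Matching.

(** * A random round over edges padded with dummies *)

Section Nibble.
Local Open Scope ring_scope.
Variables (R : realFieldType) (V Ed I : finType) (inc : Ed -> {set V}).
(** [I] holds the edges, embedded by [emb], and the dummies; [star v] collects the items at [v]. The
    random choice is made in [I]. *)
Variables (star : V -> {set I}) (emb : Ed -> I) (E : {set Ed}) (k D c : nat).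
Hypothesis emb_inj : injective emb.
Hypothesis emb_star : forall e v, e \in E -> (emb e \in star v) = (v \in inc e).
Hypothesis uniform : {in E, forall e, #|inc e| = k}.
Hypothesis k_gt0 : (0 < k)%N.
Hypothesis card_star : forall v, #|star v| = D.
Hypothesis codeg : forall u v, u != v -> (#|star u :&: star v| <= c)%N.

Implicit Types (U : {set V}) (S : {set I}).

Definition touch (U : {set V}) : {set I} := \bigcup_(u in U) star u.

Lemma emb_touch e U : e \in E -> (emb e \in touch U) = ~~ [disjoint inc e & U].
Proof.
move=> eE; apply/bigcupP/pred0Pn => -[u].
  by move=> uU; rewrite emb_star // => ue; exists u; rewrite !inE ue.
by move=> /andP[ue uU]; exists u; rewrite ?emb_star.
Qed.

Lemma touchU1 u U : touch (u |: U) = star u :|: touch U.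
Proof. by rewrite /touch bigcup_setU big_set1. Qed.

Lemma card_touch_le U : (#|touch U| <= #|U| * D)%N.
Proof.
apply: leq_trans (card_bigcup_le _ _) _.
by rewrite (eq_bigr (fun=> D)) // sum_nat_const.
Qed.

Lemma card_star_touch v U : v \notin U -> (#|star v :&: touch U| <= #|U| * c)%N.
Proof.
move=> vU; rewrite /touch big_distrr /=.
apply: leq_trans (card_bigcup_le _ _) _; rewrite -sum_nat_const.
by apply: leq_sum => u uU; apply: codeg; apply: contraNneq vU => ->.
Qed.

(** Adding the vertices one at a time, each new star meets the earlier ones in at most [#|U| * c]
    items, so the sizes almost add up. *)
Lemma card_touch_ge U : (#|U| * D <= #|touch U| + #|U| * #|U| * c)%N.
Proof.
have [m] := ubnP #|U|; elim: m U => // m IH U; rewrite ltnS => Um.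
have [->|[u uU]] := set_0Vmem U; first by rewrite cards0.
rewrite -(setD1K uU) touchU1 [#|star u :|: _|]cardsU card_star.
have uU' : u \notin U :\ u by rewrite !inE eqxx.
rewrite cardsU1 uU' /=.
have := IH (U :\ u); rewrite (cardsD1 u U) uU in Um; move=> /(_ Um).
have := card_star_touch uU'; have : (#|star u :&: touch (U :\ u)| <= D)%N.
  by rewrite -(card_star u) subset_leq_card // subsetIl.
by nia.
Qed.

Lemma card_touch_far v U : v \notin U ->
  (#|U| * D <= #|touch U :\: star v| + (#|U| * #|U| + #|U|) * c)%N.
Proof.
move=> vU; have := card_touch_ge U; have := card_star_touch vU.
by rewrite cardsD setIC; lia.
Qed.

Variable p : R.
Hypotheses (p_ge0 : 0 <= p) (p_le1 : p <= 1) (pD : p * D%:R <= 1).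

Let P := @expect R I p.
(** This is [s ^+ k.-1] for the survival probability [s = (1 - p) ^+ D] of a vertex; [y] below is
    [s ^+ k]. *)
Let x : R := (1 - p) ^+ (k.-1 * D).

(* The items of [star v] are excluded because no edge at [v] survives once one of
   them is chosen; this keeps [far_free v] concentrated around [s^(k-1) deg v]. *)
Definition far v e := touch (inc e :\ v) :\: star v.

Definition far_free v S : R := \sum_(e in edges_at inc E v) [disjoint S & far v e]%:R.

Lemma card_near v e : e \in edges_at inc E v -> #|inc e :\ v| = k.-1.
Proof.
rewrite inE => /andP[eE ve].
by have := uniform eE; rewrite (cardsD1 v) ve => <-.
Qed.

Lemma card_edges_at v : (#|edges_at inc E v| <= D)%N.
Proof.
rewrite -(card_star v) -(card_imset (mem (edges_at inc E v)) emb_inj).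
apply/subset_leq_card/subsetP.
by move=> i /imsetP[e]; rewrite inE => /andP[eE ve] ->; rewrite emb_star.
Qed.

(** Overlapping stars shrink the set to be avoided, which makes the event more likely. *)
Lemma expect_far v e :
  e \in edges_at inc E v -> x <= P (fun S : {set I} => [disjoint S & far v e]%:R).
Proof.
move=> ev; rewrite /P expect_avoid ler_wiXn2l ?subr_ge0 ?gerBl //.
rewrite -(card_near ev); apply: leq_trans (card_touch_le _).
by rewrite subset_leq_card // subsetDl.
Qed.

(** If the edges share only [v], their far sets together miss few of the [2 * k.-1 * D] items
    counted with multiplicity, so the events are nearly independent. Otherwise the last term makes
    the bound trivial. *)
Lemma expect_far2 v e f :
    e \in edges_at inc E v -> f \in edges_at inc E v ->
  P (fun S : {set I} => [disjoint S & far v e]%:R * [disjoint S & far v f]%:R) <=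
  x ^+ 2 + (4 * k ^ 2 * c)%:R * p + (~~ [disjoint inc e :\ v & inc f :\ v])%:R.
Proof.
move=> ev fv; rewrite (_ : P _ = (1 - p) ^+ #|far v e :|: far v f|); last first.
  rewrite -expect_avoid; apply: eq_expect => S.
  by rewrite -natrM mulnb -!setI_eq0 setIUr setU_eq0.
case: (boolP [disjoint _ & _]) => [dis|_] /=; last first.
  apply: le_trans (_ : 1 <= _); first by rewrite exprn_ile1 ?subr_ge0 ?gerBl.
  by rewrite lerDr addr_ge0 ?exprn_ge0 ?mulr_ge0 ?subr_ge0.
rewrite addr0 /x -exprM; apply: expr1B_sub => //.
rewrite -setDUl /touch -bigcup_setU -/(touch _).
set U := _ :|: _; have vU : v \notin U by rewrite !inE eqxx.
have := card_touch_far vU; have -> : #|U| = (k.-1 + k.-1)%N.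
  by move: dis; rewrite cardsU -setI_eq0 => /eqP->; rewrite cards0 subn0 !card_near.
rewrite (_ : k.-1 * D * 2 = (k.-1 + k.-1) * D)%N => [le1|]; last by lia.
(* Here [#|U|] is [2k - 2], and [(2k - 2)(2k - 1)] is at most [4k^2]. *)
apply: leq_trans le1 _; rewrite leq_add2l leq_mul2r; apply/orP; right.
by case: (k) => // j /=; nia.
Qed.

(** Each of the [k.-1] other vertices of [e] shares at most [c] items with [v]. *)
Lemma card_meeting v e : e \in edges_at inc E v ->
  (#|[set f in edges_at inc E v | ~~ [disjoint inc e :\ v & inc f :\ v]]| <= k * c)%N.
Proof.
move=> ev; pose F u := emb @^-1: (star u :&: star v).
apply: (@leq_trans #|\bigcup_(u in inc e :\ v) (edges_at inc E v :&: F u)|).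
  apply/subset_leq_card/subsetP => f; rewrite inE => /andP[fv].
  move=> /pred0Pn[u /andP[ue]]; rewrite !inE => /andP[_ uf].
  apply/bigcupP; exists u => //; move: (fv); rewrite !inE => /andP[fE vf].
  by rewrite fE vf !emb_star // uf vf.
apply: leq_trans (card_bigcup_le _ _) _.
apply: (@leq_trans (\sum_(u in inc e :\ v) c)).
  apply: leq_sum => u; rewrite !inE => /andP[uv _]; apply: leq_trans (codeg uv).
  rewrite -(card_imset (mem (edges_at inc E v :&: F u)) emb_inj).
  apply/subset_leq_card/subsetP => i /imsetP[f]; rewrite inE => /andP[_].
  by rewrite inE => ? ->.
by rewrite sum_nat_const card_near // leq_mul2r leq_pred orbT.
Qed.

(** The centre is not the exact mean, but [expect_far] gives the linear terms the favourable sign,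
    so upper bounds on pairs suffice. As [p * D <= 1], overlap errors total at most [4k^2 c D];
    pairs meeting outside [v] add at most [k c D]. *)
Lemma far_free_variance v :
  P (fun S : {set I} => (far_free v S - #|edges_at inc E v|%:R * x) ^+ 2)
  <= (5 * k ^ 2 * c * D)%:R.
Proof.
pose d e (S : {set I}) : R := [disjoint S & far v e]%:R.
have x0 : 0 <= x by rewrite exprn_ge0 ?subr_ge0.
rewrite (_ : P _ = \sum_(e in edges_at inc E v) \sum_(f in edges_at inc E v)
    P (fun S : {set I} => (d e S - x) * (d f S - x))); last first.
  under eq_bigr do rewrite /P -expect_sum.
  rewrite /P -expect_sum; apply: eq_expect => S.
  rewrite /far_free mulr_natl -sumr_const -sumrB expr2 mulr_suml.
  by apply: eq_bigr => e _; rewrite mulr_sumr.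
have step e f : e \in edges_at inc E v -> f \in edges_at inc E v ->
    P (fun S : {set I} => (d e S - x) * (d f S - x)) <=
    (4 * k ^ 2 * c)%:R * p + (~~ [disjoint inc e :\ v & inc f :\ v])%:R.
  move=> ev fv; rewrite (_ : P _ = P (fun S : {set I} => d e S * d f S)
      + (- x * P (d e) + (- x * P (d f) + x ^+ 2))); last first.
    have <- : P (fun=> x ^+ 2) = x ^+ 2 by exact: expect_cst.
    rewrite /P -!expectZ -!expectD.
    by apply: eq_expect => S; ring.
  have xe : x <= P (d e) := expect_far ev.
  have xf : x <= P (d f) := expect_far fv.
  have def : P (fun S : {set I} => d e S * d f S) <= _ := expect_far2 ev fv.
  move: x0 xe xf def; move: (P _) (P (d e)) (P (d f)) => g a b.
  move: (_%:R) (_ * p) => j h; move: x => y; nra.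
apply: le_trans (_ : \sum_(e in edges_at inc E v) (5 * k ^ 2 * c)%:R <= _); last first.
  by rewrite sumr_const -mulrnA ler_nat leq_mul2l card_edges_at orbT.
apply: ler_sum => e ev; apply: le_trans (ler_sum _ (fun f fv => step e f ev fv)) _.
rewrite big_split /= sumr_const -mulrnAr -natr_sum.
rewrite (_ : (5 * k ^ 2 * c = 4 * k ^ 2 * c + k ^ 2 * c)%N) ?natrD; last by lia.
apply: lerD.
  rewrite ler_piMr //; apply: le_trans pD; rewrite -mulr_natr.
  by rewrite ler_wpM2l // ler_nat card_edges_at.
rewrite ler_nat.
rewrite (eq_bigr (fun f => if ~~ [disjoint inc e :\ v & inc f :\ v] then 1 else 0)%N);
  last by move=> f _; case: [disjoint _ & _].
rewrite -big_mkcondr sum1dep_card /=.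
apply: leq_trans (_ : k * c <= _)%N; last by nia.
apply: leq_trans (card_meeting ev); apply/subset_leq_card/subsetP => f.
by rewrite !inE.
Qed.

(** Chosen dummies kill vertices too, so that each vertex escapes with the same probability. *)
Definition survivors S := [set e in E | [disjoint S & touch (inc e)]].

Definition isolated S := [set e in E | S :&: touch (inc e) == [set emb e]].

Lemma card_inc_gt0 e : e \in E -> exists v, v \in inc e.
Proof. by move=> eE; apply/card_gt0P; rewrite uniform. Qed.

Lemma emb_touch_inc e : e \in E -> emb e \in touch (inc e).
Proof.
move=> eE; rewrite emb_touch //; have [v ve] := card_inc_gt0 eE.
by apply/pred0Pn; exists v; rewrite /= ve.
Qed.

Lemma isolated_chosen S e : e \in isolated S -> emb e \in S.
Proof. by rewrite inE => /andP[_ /eqP/setP/(_ (emb e))]; rewrite !inE eqxx => /andP[]. Qed.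

Lemma is_matching_isolated S : is_matching inc (isolated S).
Proof.
apply/is_matchingP => e f eM fM ef; have fS := isolated_chosen fM.
have fE : f \in E by move: fM; rewrite inE => /andP[].
rewrite disjoint_sym; apply: negbNE; rewrite -emb_touch //; apply/negP => ft.
move: eM; rewrite inE => /andP[_ /eqP/setP/(_ (emb f))].
by rewrite !inE fS ft (inj_eq emb_inj) eq_sym (negPf ef).
Qed.

Lemma isolated_survivors S :
  {in isolated S & survivors S, forall e f, [disjoint inc e & inc f]}.
Proof.
move=> e f eM; rewrite inE => /andP[fE dis].
have eE : e \in E by move: eM; rewrite inE => /andP[].
apply: negbNE; rewrite -emb_touch //; apply/negP => et.
by rewrite (disjointFr dis (isolated_chosen eM)) in et.
Qed.

Lemma survivors_at S v :
  #|edges_at inc (survivors S) v|%:R <= far_free v S.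
Proof.
rewrite /far_free -natr_sum ler_nat.
rewrite (eq_bigr (fun e => if [disjoint S & far v e] then 1 else 0)%N);
  last by move=> e _; case: [disjoint _ & _].
rewrite -big_mkcondr sum1dep_card; apply/subset_leq_card/subsetP => e.
rewrite !inE => /andP[/andP[-> dis] ->] /=; apply: disjointWr dis.
apply: subset_trans (subsetDl _ _) _; apply/bigcupsP => u.
by rewrite !inE => /andP[_ ue]; apply: bigcup_sup.
Qed.

Lemma sum_card_edges_at : (\sum_v #|edges_at inc E v| = #|E| * k)%N.
Proof.
rewrite -sum_nat_const -(eq_bigr _ uniform).
under eq_bigr do rewrite -sum1_card.
under [RHS]eq_bigr do rewrite -sum1_card.
rewrite (exchange_big_dep (mem E)) /=; last by move=> v e _; rewrite inE => /andP[].
by apply: eq_bigr => e eE; apply: eq_bigl => v; rewrite inE eE.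
Qed.

Let y : R := (1 - p) ^+ (k * D).

Lemma expect_isolated : #|E|%:R * (p * y) <= P (fun S : {set I} => #|isolated S|%:R).
Proof.
rewrite (_ : P _ = \sum_(e in E)
    P (fun S : {set I} => (S :&: touch (inc e) == [set emb e])%:R)); last first.
  rewrite /P -expect_sum; apply: eq_expect => S; rewrite -natr_sum -sum1dep_card.
  by rewrite big_mkcondr; congr _%:R; apply: eq_bigr => e _; case: eqP.
rewrite mulr_natl -sumr_const; apply: ler_sum => e eE.
rewrite /P expect_single ?emb_touch_inc // ler_wpM2l // ler_wiXn2l ?subr_ge0 ?gerBl //.
by apply: leq_trans (leq_pred _) _; rewrite -(uniform eE) card_touch_le.
Qed.

Lemma expect_survivors : #|E|%:R * y <= P (fun S : {set I} => #|survivors S|%:R).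
Proof.
rewrite (_ : P _ = \sum_(e in E)
    P (fun S : {set I} => [disjoint S & touch (inc e)]%:R)); last first.
  rewrite /P -expect_sum; apply: eq_expect => S; rewrite -natr_sum -sum1dep_card.
  by rewrite big_mkcondr; congr _%:R; apply: eq_bigr => e _; case: [disjoint _ & _].
rewrite mulr_natl -sumr_const; apply: ler_sum => e eE.
rewrite /P expect_avoid ler_wiXn2l ?subr_ge0 ?gerBl //.
by rewrite -(uniform eE) card_touch_le.
Qed.

Variables (D' : nat) (g : R).
Hypotheses (g_gt0 : 0 < g) (D'_ge : D%:R * x + g <= D'%:R).

Definition overloaded S v := D'%:R < far_free v S.

(** Chebyshev: the degree in [E] is at most [D], so an overloaded vertex deviates from the centre by
    at least [g]. *)
Lemma expect_overloaded v :
  P (fun S : {set I} => (overloaded S v)%:R) <= (5 * k ^ 2 * c * D)%:R / g ^+ 2.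
Proof.
have gV : 0 <= g ^- 2 by rewrite invr_ge0 exprn_ge0 // ltW.
apply: le_trans (_ : P (fun S : {set I} => g ^- 2 *
    (far_free v S - #|edges_at inc E v|%:R * x) ^+ 2) <= _); last first.
  by rewrite /P expectZ mulrC ler_wpM2r //; apply: far_free_variance.
apply: expect_le => // S; case: (boolP (overloaded S v)) => [ov|_] /=; last first.
  by rewrite mulr_ge0 ?sqr_ge0.
rewrite mulrC ler_pdivlMr ?exprn_gt0 // mul1r.
suff gle : g <= far_free v S - #|edges_at inc E v|%:R * x.
  by rewrite ler_pXn2r ?nnegrE //; [exact: ltW|exact: le_trans (ltW g_gt0) gle].
rewrite lerBrDr addrC; apply: le_trans (ltW ov); apply: le_trans D'_ge.
by rewrite lerD2r ler_wpM2r ?ler_nat ?card_edges_at // exprn_ge0 ?subr_ge0.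
Qed.

(** Discarding the edges at overloaded vertices makes the degree bound [D'] valid for every
    outcome. *)
Definition retained S : {set Ed} :=
  [set e in survivors S | [forall v in inc e, ~~ overloaded S v]].

Lemma card_retained_at S v : (#|edges_at inc (retained S) v| <= D')%N.
Proof.
case: (boolP (overloaded S v)) => [ov|].
  rewrite (_ : edges_at _ _ _ = set0) ?cards0 //; apply/setP => e; rewrite !inE.
  by apply/negP => /andP[/andP[_ /forall_inP nov] /nov]; rewrite ov.
rewrite -leNgt => Yle; rewrite -(ler_nat R).
apply: le_trans Yle; apply: le_trans (survivors_at S v); rewrite ler_nat.
by apply/subset_leq_card/subsetP => e; rewrite !inE => /andP[/andP[-> _] ->].
Qed.

(** Lost edges are charged to the degrees in [E], which are not random, so only overload
    probabilities enter the expectation. *)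
Lemma card_survivors_le S :
  #|survivors S|%:R
  <= #|retained S|%:R + \sum_v (#|edges_at inc E v|%:R * (overloaded S v)%:R) :> R.
Proof.
rewrite (eq_bigr (fun v => (#|edges_at inc E v| * overloaded S v)%N%:R)) => [|v _];
  last by rewrite natrM.
rewrite -natr_sum -natrD ler_nat.
apply: leq_trans (_ : #|retained S| +
    #|\bigcup_(v | overloaded S v) edges_at inc E v| <= _)%N; last first.
  rewrite leq_add2l; apply: leq_trans (card_bigcup_le _ _) _.
  by rewrite big_mkcond; apply: leq_sum => v _; case: ifP => _; rewrite ?muln1 ?muln0.
apply: leq_trans (leq_card_setU _ _); apply/subset_leq_card/subsetP => e eS.
rewrite in_setU inE eS /=; case: (boolP [forall _ in _, _]) => //=.
rewrite negb_forall_in => /exists_inP[v ve]; rewrite negbK => ov.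
apply/bigcupP; exists v => //; rewrite inE ve andbT.
by move: eS; rewrite inE => /andP[].
Qed.

(** Isolated edges and a maximum matching of the retained ones form a matching of [E]. This holds
    for every [S], so averaging suffices; the factor [k] comes from counting incidences. *)
Lemma nibble_step (beta : R) : 0 <= beta ->
    (forall E' : {set Ed}, E' \subset E -> (forall v, #|edges_at inc E' v| <= D')%N ->
       beta * #|E'|%:R <= D'%:R * (nu inc E')%:R) ->
  #|E|%:R * (p * y + beta / D'%:R * (y - k%:R * ((5 * k ^ 2 * c * D)%:R / g ^+ 2)))
  <= (nu inc E)%:R.
Proof.
move=> beta0 IH; set b := beta / D'%:R.
have y0 : 0 <= y by rewrite exprn_ge0 ?subr_ge0.
have D'0 : 0 < D'%:R :> R.
  by apply: lt_le_trans D'_ge; rewrite ltr_wpDl // mulr_ge0 // exprn_ge0 ?subr_ge0.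
have b0 : 0 <= b by rewrite divr_ge0 // ltW.
have pw (S : {set I}) : #|isolated S|%:R + b * #|retained S|%:R <= (nu inc E)%:R.
  have rS : retained S \subset E.
    by apply/subsetP => e; rewrite !inE => /andP[/andP[]].
  have [M [ME MM nuM]] := nu_witness inc (retained S).
  apply: le_trans (_ : #|isolated S|%:R + #|M|%:R <= _).
    rewrite lerD2l /b mulrAC ler_pdivrMr // [X in _ <= X]mulrC -nuM.
    by apply: IH => // v; apply: card_retained_at.
  have dis : {in isolated S & M, forall e f, [disjoint inc e & inc f]}.
    move=> e f eS fM; apply: isolated_survivors eS _.
    by have := subsetP ME f fM; rewrite inE => /andP[].
  rewrite -natrD ler_nat -cardsUI (_ : _ :&: M = set0) ?cards0 ?addn0.
    apply: nu_ge; last exact: is_matchingU (is_matching_isolated S) MM dis.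
    rewrite subUset (subset_trans ME rS) andbT.
    by apply/subsetP => e; rewrite inE => /andP[].
  (* An edge in both sets would be disjoint from itself, yet it has a vertex. *)
  apply/setP => e; rewrite !inE; apply/negP => /andP[/andP[eE eS] eM].
  have [v ve] := card_inc_gt0 eE.
  have eI : e \in isolated S by rewrite inE eE.
  by have := disjointFr (dis e e eI eM) ve; rewrite ve.
have : P (fun S : {set I} => #|isolated S|%:R + b * (#|survivors S|%:R +
    (-1) * \sum_v (#|edges_at inc E v|%:R * (overloaded S v)%:R))) <= (nu inc E)%:R.
  rewrite -[X in _ <= X](expect_cst I p); apply: expect_le => // S.
  apply: le_trans (pw S); rewrite lerD2l ler_wpM2l // mulN1r lerBlDr.
  exact: card_survivors_le.
apply: le_trans; rewrite /P expectD expectZ expectD expectZ expect_sum mulrDr.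
apply: lerD; first exact: expect_isolated.
rewrite mulrCA ler_wpM2l // mulrBr; apply: lerD; first exact: expect_survivors.
rewrite mulN1r lerN2 [#|E|%:R * (_ * _)]mulrA -natrM -sum_card_edges_at natr_sum mulr_suml.
by apply: ler_sum => v _; rewrite expectZ ler_wpM2l // expect_overloaded.
Qed.

End Nibble.

(** * Matchings in uniform hypergraphs of small codegree *)

Section Padding.
Variables (V Ed : finType) (inc : Ed -> {set V}) (E : {set Ed}) (D : nat).

(** Each dummy belongs to a single vertex, so padding leaves the codegrees unchanged. *)
Definition padded_star v : {set Ed + V * 'I_D} :=
  [set i : Ed + V * 'I_D | match i with
           | inl e => e \in edges_at inc E v
           | inr (w, j) => (w == v) && (j < D - #|edges_at inc E v|)%N
           end].

Lemma inl_padded_star e v :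
  e \in E -> (inl e \in padded_star v) = (v \in inc e).
Proof. by move=> eE; rewrite !inE eE. Qed.

Lemma card_padded_star v : (#|edges_at inc E v| <= D)%N -> #|padded_star v| = D.
Proof.
move=> degv; set m := (D - #|edges_at inc E v|)%N.
have mD : (m <= D)%N by rewrite leq_subr.
rewrite (_ : padded_star v = inl @: edges_at inc E v :|:
    (fun j : 'I_m => inr (v, widen_ord mD j)) @: setT); last first.
  apply/setP => -[e|[w j]]; rewrite !inE.
    rewrite (mem_imset _ _ inl_inj) inE orbC.
    by case: imsetP => [[]|].
  rewrite (introF imsetP) => [|[]] //=; apply/andP/imsetP.
    move=> [/eqP-> jm]; exists (Ordinal jm) => //.
    by congr (inr (_, _)); apply: val_inj.
  by move=> [i _ [-> ->]]; rewrite eqxx /=.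
rewrite cardsU (_ : _ :&: _ = set0) ?cards0 ?subn0.
  rewrite !card_imset; [|by move=> i j [/val_inj]|exact: inl_inj].
  by rewrite cardsT card_ord subnKC.
apply/setP => i; rewrite !inE; apply/negP => /andP[/imsetP[e _ ->]].
by case/imsetP.
Qed.

Lemma card_padded_starI u v : u != v ->
  #|padded_star u :&: padded_star v| = #|edges_at inc E u :&: edges_at inc E v|.
Proof.
move=> uv; rewrite -[RHS](card_imset _ (@inl_inj _ (V * 'I_D)%type)).
apply: eq_card => -[e|[w j]]; rewrite !inE.
  by rewrite (mem_imset _ _ inl_inj) !inE.
rewrite (introF imsetP) => [|[]] //; apply/negP.
by move=> /andP[/andP[/eqP-> _]]; rewrite (negPf uv).
Qed.

End Padding.

(** * Pippenger's theorem by repeated gains *)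

Section Pippenger.
Local Open Scope ring_scope.
Variable R : archiRealFieldType.

(** [delta] is uniform over all hypergraphs, and the target counts edges rather than vertices:
    degrees need only an upper bound, which is all that a round provides for the rest. *)
Definition packable (k : nat) (beta : R) : Prop :=
  exists2 delta : R, 0 < delta &
  forall (V Ed : finType) (inc : Ed -> {set V}) (E : {set Ed}) (D : nat),
    {in E, forall e, #|inc e| = k} ->
    (forall v, #|edges_at inc E v| <= D)%N ->
    (forall u v, u != v ->
       #|edges_at inc E u :&: edges_at inc E v|%:R <= delta * D%:R) ->
    1 <= delta * D%:R ->
    beta * #|E|%:R <= D%:R * (nu inc E)%:R.

Lemma packable0 k : packable k 0.
Proof.
by exists 1 => // V Ed inc E D _ _ _ _; rewrite mul0r mulr_ge0.
Qed.

Lemma packable_le k a b : a <= b -> packable k b -> packable k a.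
Proof.
move=> ab [delta delta0 H]; exists delta => // V Ed inc E D h1 h2 h3 h4.
by apply: le_trans (H V Ed inc E D h1 h2 h3 h4); rewrite ler_wpM2r.
Qed.

(** Up to errors, isolated edges bring [theta * (1 - k * theta)] and the rest [beta * (1 - theta)].
    As [beta <= 1 - eps] and [k * theta = eps / 2], the gain is at least
    [theta * eps / 2 = 2 * kappa], half of which pays for the errors. *)
Lemma packable_gain k (eps beta : R) : (0 < k)%N -> 0 < eps -> eps <= 1 ->
  0 <= beta -> beta <= 1 - eps -> packable k beta ->
  packable k (beta + eps ^+ 2 / (8 * k%:R)).
Proof.
move=> k0 e0 e1 b0 be [db db0 IH].
have kR : 1 <= k%:R :> R by rewrite ler1n.
pose theta := eps / (2 * k%:R); pose kappa := theta * eps / 4.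
have -> : eps ^+ 2 / (8 * k%:R) = kappa by rewrite /kappa /theta; field; lra.
have th0 : 0 < theta by rewrite divr_gt0 //; lra.
have kth : k%:R * theta = eps / 2 by rewrite /theta; field; lra.
have th1 : theta <= 2^-1 by rewrite ler_pdivrMr; nra.
have ka0 : 0 < kappa by rewrite /kappa; nra.
have ka1 : kappa <= 4^-1 by rewrite /kappa; nra.
(* Error budget: [Gam <= kappa * x] because [x] is at least [2 ^- k]. The degree slack [gam] and the
   rounding of [D'] use at most [Gam / 2], overloaded vertices the other half. *)
pose Gam := kappa / 2 ^+ k; pose gam := Gam / 4.
have p2 : 0 < 2 ^+ k :> R by rewrite exprn_gt0.
have Gam0 : 0 < Gam by rewrite divr_gt0.
have gam0 : 0 < gam by rewrite divr_gt0.
(* The three bounds serve the rounding of [D'], the second-moment error, and the hypotheses of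
   [packable] at [D'], which is at least [D / 2 ^+ k]. *)
pose delta := Num.min gam (Num.min (Gam * gam ^+ 2 / (10 * k%:R ^+ 3)) (db / 2 ^+ k)).
have k3 : 0 < 10 * k%:R ^+ 3 :> R by rewrite mulr_gt0 // exprn_gt0 //; lra.
have delta0 : 0 < delta.
  by rewrite !lt_min gam0 !divr_gt0 // mulr_gt0 // exprn_gt0.
have [dgam dGam ddb] : [/\ delta <= gam, 5 * k%:R ^+ 3 * delta / gam ^+ 2 <= Gam / 2
    & delta * 2 ^+ k <= db].
  have : delta <= delta by []; rewrite {2}/delta !le_min => /and3P[-> d2 d3].
  split=> //; last by rewrite -ler_pdivlMr.
  by move: d2; rewrite ler_pdivlMr // ler_pdivrMr ?exprn_gt0 //; lra.
exists delta => // V Ed inc E D unif degE codegE deltaD.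
have D0 : 0 < D%:R :> R by nra.
pose p := theta / D%:R.
have pDE : p * D%:R = theta by rewrite /p divfK // gt_eqF.
have D1 : 1 <= D%:R :> R by move: D0; rewrite ltr0n ler1n.
have p0 : 0 <= p by rewrite divr_ge0 // ltW.
have p1 : p <= 1 by rewrite ler_pdivrMr // mul1r; lra.
have pD : p * D%:R <= 1 by rewrite pDE; lra.
have q0 : 0 <= 1 - p by rewrite subr_ge0.
have q1 : 1 - p <= 1 by rewrite gerBl.
pose s := (1 - p) ^+ D; pose x := (1 - p) ^+ (k.-1 * D); pose y := (1 - p) ^+ (k * D).
have s1 : s <= 1 by exact: exprn_ile1.
have sth : 1 - theta <= s.
  have := @expr1B_sub _ p p0 p1 0 D D (leqnn _).
  by rewrite expr0 mulrC pDE -/s; lra.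
have yE : y = s * x by rewrite /y /s /x -exprD -mulSn prednK.
have yth : 1 - k%:R * theta <= y.
  have := @expr1B_sub _ p p0 p1 0 (k * D) (k * D) (leqnn _).
  by rewrite expr0 natrM -mulrA [D%:R * p]mulrC pDE -/y; lra.
have x1 : x <= 1 by exact: exprn_ile1.
have x0 : 0 <= x by exact: exprn_ge0.
have xlow : 1 <= x * 2 ^+ k.
  rewrite /x mulnC exprM -/s.
  apply: le_trans (_ : s ^+ k * 2 ^+ k <= _); last first.
    rewrite ler_wpM2r ?(ltW p2) //.
    by apply: ler_wiXn2l; rewrite ?leq_pred //; lra.
  by rewrite -exprMn exprn_ege1 //; lra.
(* Rounding up adds at most 1, which is at most [delta * D]. *)
pose D' := (Num.truncn (D%:R * x + gam * D%:R)).+1.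
have /truncn_itv/andP[D'up D'low] : 0 <= D%:R * x + gam * D%:R.
  by rewrite addr_ge0 // mulr_ge0 // ltW.
have {}D'up : D'%:R <= D%:R * (x + gam + delta).
  by rewrite /D' -natr1; lra.
rewrite -/D' in D'low.
pose c := Num.truncn (delta * D%:R).
have dD0 : 0 <= delta * D%:R by rewrite mulr_ge0 // ltW.
have cle : c%:R <= delta * D%:R by rewrite truncn_le.
have starI u v : u != v ->
    (#|padded_star inc E D u :&: padded_star inc E D v| <= c)%N.
  by move=> uv; rewrite card_padded_starI // truncn_ge_nat // codegE.
have := @nibble_step R V Ed _ inc (padded_star inc E D) inl E k D c inl_inj
  (fun e v => inl_padded_star inc D v) unif k0
  (fun v => card_padded_star (degE v)) starI p p0 p1 pD D' (gam * D%:R)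
  (mulr_gt0 gam0 D0) (ltW D'low) beta b0.
have IH' (E' : {set Ed}) : E' \subset E -> (forall v, #|edges_at inc E' v| <= D')%N ->
    beta * #|E'|%:R <= D'%:R * (nu inc E')%:R.
  move=> E'E deg'.
  have dbD' : delta * D%:R <= db * D'%:R.
    apply: le_trans (_ : db * (D%:R * x) <= _).
      apply: le_trans (_ : delta * 2 ^+ k * (D%:R * x) <= _).
        rewrite (_ : _ * _ * _ = delta * D%:R * (x * 2 ^+ k)); last by ring.
        by rewrite ler_peMr.
      by rewrite ler_wpM2r // mulr_ge0 // ltW.
    rewrite ler_wpM2l ?(ltW db0) //; apply: le_trans (ltW D'low).
    by rewrite lerDl mulr_ge0 // ltW.
  apply: IH => //.
  - by move=> e /(subsetP E'E) /unif.
  - move=> u v uv; apply: le_trans dbD'; apply: le_trans (codegE u v uv).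
    rewrite ler_nat; apply/subset_leq_card/subsetP => e; rewrite !inE.
    by move=> /andP[/andP[/(subsetP E'E)-> ->] /andP[_ ->]].
  - exact: le_trans deltaD dbD'.
move=> /(_ IH') {IH' IH starI}; rewrite -/y.
set eta := (_ / (gam * D%:R) ^+ 2); set N := (nu _ _)%:R => main.
(* Since [c <= delta * D], the powers of [D] cancel. *)
have etale : k%:R * eta <= Gam / 2.
  apply: le_trans dGam; rewrite /eta !natrM exprMn.
  rewrite (_ : 5 * k%:R ^+ 3 * delta / gam ^+ 2 = k%:R * (5 * (k%:R * k%:R) *
    (delta * D%:R) * D%:R / (gam ^+ 2 * D%:R ^+ 2))); last first.
    by field; rewrite !gt_eqF.
  rewrite ler_wpM2l //; apply: ler_wpM2r.
    by rewrite invr_ge0; apply: mulr_ge0; apply: sqr_ge0.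
  by rewrite ler_wpM2r // ler_wpM2l // !mulr_ge0.
have D'0 : 0 < D'%:R :> R by rewrite ltr0n.
(* Edges shrink by [s * x] and the degree bound by about [x], so their ratio shrinks only by [s], up
   to [kappa]. *)
have key : (s - kappa) * D'%:R <= D%:R * (y - k%:R * eta).
  apply: le_trans (_ : (s - kappa) * (D%:R * (x + gam + delta)) <= _).
    by rewrite ler_wpM2l // subr_ge0; lra.
  rewrite mulrCA ler_wpM2l // yE.
  have kx : Gam <= kappa * x.
    rewrite /Gam ler_pdivrMr // -mulrA ler_peMr //; exact: ltW.
  have gE : Gam = 4 * gam by rewrite /gam; field.
  have sk : (s - kappa) * (gam + delta) <= gam + delta by rewrite ler_piMl; lra.
  lra.
have low : s - kappa <= D%:R * (y - k%:R * eta) / D'%:R by rewrite ler_pdivlMr.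
apply: le_trans (ler_wpM2l (ltW D0) main).
rewrite mulrC [D%:R * _]mulrCA ler_wpM2l //.
rewrite (_ : D%:R * _ = theta * y + beta * (D%:R * (y - k%:R * eta) / D'%:R));
  last by rewrite -pDE; field; rewrite gt_eqF.
apply: le_trans (_ : theta * (1 - k%:R * theta) + beta * (s - kappa) <= _); last first.
  by apply: lerD; rewrite ler_wpM2l // ltW.
rewrite kth.
have : beta * (1 - theta - kappa) <= beta * (s - kappa) by rewrite ler_wpM2l //; lra.
have : theta * beta <= theta * (1 - eps) by rewrite ler_wpM2l // ltW.
have : beta * kappa <= kappa by rewrite ler_piMl ?(ltW ka0) //; lra.
have : kappa = theta * eps / 4 by [].
lra.
Qed.

(** The gain does not depend on [beta], so finitely many rounds reach [1 - eps], where the minimum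
    stops them. *)
Lemma packable_lt1 k (eps : R) : (0 < k)%N -> 0 < eps -> packable k (1 - eps).
Proof.
move=> k0 e0; wlog e1 : eps e0 / eps <= 1.
  move=> H; have [|/ltW e1] := leP eps 1; first exact: H.
  by apply: packable_le (H 1 _ _) => //; rewrite lerD2l lerN2.
pose kap := eps ^+ 2 / (8 * k%:R).
have kap0 : 0 < kap by rewrite divr_gt0 ?exprn_gt0 ?mulr_gt0 ?ltr0n.
have pk j : packable k (Num.min (j%:R * kap) (1 - eps)).
  elim: j => [|j IH]; first by apply: packable_le (packable0 k); rewrite mul0r ge_min lexx.
  have [jk|jk] := leP (j%:R * kap) (1 - eps).
    apply: packable_le (packable_gain k0 e0 e1 _ jk _).
    - by rewrite -/kap -natr1 mulrDl mul1r ge_min lexx.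
    - by rewrite mulr_ge0 // ltW.
    - by rewrite (min_idPl jk) in IH.
  by apply: packable_le IH; rewrite (min_idPr (ltW jk)) ge_min lexx orbT.
apply: packable_le (pk (Num.bound kap^-1)); rewrite le_min lexx andbT.
apply: le_trans (_ : 1 <= _); first by rewrite gerBl ltW.
by rewrite -ler_pdivrMr // mul1r ltW // archi_boundP // invr_ge0 ltW.
Qed.

End Pippenger.

(** * The hypergraph of words *)

Lemma ex_subset_card (T : finType) (A : {set T}) m :
  m <= #|A| -> exists2 B : {set T}, B \subset A & #|B| = m.
Proof.
rewrite -bin_gt0 -(cards_draws A) => /card_gt0P[B]; rewrite inE => /andP[BA /eqP].
by exists B.
Qed.

Lemma card_supersets (T : finType) (U : {set T}) w : #|U| <= w ->
  #|[set W : {set T} | (U \subset W) && (#|W| == w)]| = 'C(#|T| - #|U|, w - #|U|).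
Proof.
move=> Uw; have -> : #|T| - #|U| = #|~: U| by rewrite [RHS]cardsCs setCK.
rewrite -cards_draws.
rewrite -[RHS](card_in_imset (f := fun B => U :|: B)) => [|A B]; last first.
  rewrite !inE => /andP[AU _] /andP[BU _] /setP AB; apply/setP => i.
  have := AB i; rewrite !inE; case: (boolP (i \in U)) => //= iU _.
  have out (C : {set T}) : C \subset ~: U -> (i \in C) = false.
    by move=> CU; apply: contraTF iU => /(subsetP CU); rewrite inE.
  by rewrite !out.
apply: eq_card => W; rewrite !inE; apply/andP/imsetP.
  move=> [UW /eqP Ww]; exists (W :\: U).
    by rewrite inE {1}setDE subsetIr cardsD (setIidPr UW) Ww eqxx.
  apply/setP => i; rewrite !inE; have := subsetP UW i.
  by case: (i \in U) => //= ->.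
move=> [B]; rewrite inE -disjoints_subset => /andP[BU /eqP Bc] ->.
rewrite subsetUl cardsU setIC (disjoint_setI0 BU) cards0 Bc subn0 subnKC //.
Qed.

Section Words.
Variables q n : nat.
(** From here on [q] counts the nonzero letters, and [ord0] is the zero letter. *)
Local Notation word := (word q.+1 n).
Implicit Types (u x y : word) (P W : {set 'I_n}).

Definition supp x : {set 'I_n} := [set i | x i != 0 :> nat].

Definition subword u x := [forall i, (i \in supp u) ==> (x i == u i)].

Definition restrict x P : word := [ffun i => if i \in P then x i else ord0].

Lemma supp_restrict x P : supp (restrict x P) = P :&: supp x.
Proof. by apply/setP => i; rewrite !inE ffunE; case: (i \in P). Qed.

Lemma subwordP u x : reflect (u = restrict x (supp u)) (subword u x).
Proof.
apply: (iffP forallP) => [ux|-> i]; last first.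
  by apply/implyP; rewrite supp_restrict ffunE inE => /andP[->].
apply/ffunP => i; rewrite ffunE; have /implyP := ux i.
by case: ifP => [_ /(_ isT)/eqP|/negbT]; rewrite // inE negbK => /eqP i0 _; apply: val_inj.
Qed.

Lemma subword_restrict x P : subword (restrict x P) x.
Proof.
by apply/forallP => i; apply/implyP; rewrite supp_restrict ffunE inE => /andP[->].
Qed.

Lemma subword_supp u x : subword u x -> supp u \subset supp x.
Proof. by move=> /subwordP->; rewrite supp_restrict subsetIr. Qed.

Lemma card_words_supp u W : supp u \subset W ->
  #|[set x | (supp x == W) && subword u x]| = q ^ (#|W| - #|supp u|).
Proof.
move=> uW.
pose F i : pred 'I_q.+1 := if i \in supp u then pred1 (u i)
  else if i \in W then predC1 ord0 else pred1 ord0.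
have -> : #|[set x | (supp x == W) && subword u x]| = #|family F|.
  apply: eq_card => x; rewrite !inE; apply/andP/familyP.
    move=> [/eqP xW /forallP ux] i; rewrite /F; have /implyP := ux i.
    case: ifP => [_ /(_ isT)//|_ _]; rewrite -xW inE.
    by case: ifP => [|/negbT]; rewrite inE // negbK.
  move=> xF; split; last first.
    apply/forallP => i; apply/implyP => iu; have := xF i.
    by rewrite /F iu inE.
  apply/eqP/setP => i; have := xF i; rewrite /F; case: ifP => iu.
    by rewrite inE => /eqP xu; rewrite (subsetP uW) // inE xu; move: iu; rewrite inE.
  by case: ifP => _; rewrite !inE // => /eqP->.
rewrite card_family foldrE big_map big_enum /=.
transitivity (\prod_(i in W :\: supp u) q); last first.
  by rewrite prod_nat_const cardsD (setIidPr uW).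
rewrite [RHS]big_mkcond; apply: eq_bigr => i _; rewrite in_setD /F.
case: ifP => _ /=; first exact: card1.
by case: ifP => _; [rewrite cardC1 card_ord|exact: card1].
Qed.

Lemma card_words_ext u w : #|supp u| <= w ->
  #|[set x : word | (wt x == w) && subword u x]|
  = 'C(n - #|supp u|, w - #|supp u|) * q ^ (w - #|supp u|).
Proof.
move=> uw; rewrite -[n in n - _]card_ord -card_supersets // -sum_nat_const -sum1_card.
rewrite (partition_big supp [pred W in [set W : {set 'I_n} | supp u \subset W & #|W| == w]]) /=.
  apply: eq_bigr => W; rewrite inE => /andP[uW /eqP <-].
  rewrite -card_words_supp // -sum1_card; apply: eq_bigl => x.
  rewrite !inE; have [<-|_] := eqVneq (supp x) W; last by rewrite andbF.
  by rewrite andbT /wt -/(supp x) eqxx.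
by move=> x; rewrite !inE => /andP[xw /subword_supp->].
Qed.

(** Union bound over the possible restrictions of the word to [P]. *)
Lemma card_words_cover P w : #|P| <= w ->
  #|[set x : word | (wt x == w) && (P \subset supp x)]|
  <= q ^ #|P| * ('C(n - #|P|, w - #|P|) * q ^ (w - #|P|)).
Proof.
move=> Pw; pose z : word := [ffun=> ord0].
have z0 : supp z = set0 by apply/setP => i; rewrite !inE ffunE.
have zP : supp z \subset P by rewrite z0 sub0set.
(* The zero word is a subword of every word, so this set holds all words of support [P]. *)
rewrite (_ : q ^ #|P| = #|[set u | (supp u == P) && subword z u]|); last first.
  by rewrite card_words_supp // z0 cards0 subn0.
rewrite -sum_nat_const.
apply: (@leq_trans #|\bigcup_(u in [set u | (supp u == P) && subword z u])
   [set x : word | (wt x == w) && subword u x]|).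
  apply/subset_leq_card/subsetP => x; rewrite inE => /andP[xw Px].
  apply/bigcupP; exists (restrict x P); rewrite inE ?xw ?subword_restrict //.
  rewrite supp_restrict (setIidPl Px) eqxx; apply/forallP => i.
  by rewrite z0 inE.
apply: leq_trans (card_bigcup_le _ _) _; apply: leq_sum => u.
by rewrite inE => /andP[/eqP uP _]; rewrite card_words_ext uP.
Qed.

(** A subword of [x] is determined by its support. *)
Lemma card_subwords x t :
  #|[set u : word | (wt u == t) && subword u x]| = 'C(wt x, t).
Proof.
rewrite -cards_draws -[LHS](card_in_imset (f := supp)) => [|u v]; last first.
  rewrite !inE => /andP[_ /subwordP ux] /andP[_ /subwordP vx] uv.
  by rewrite ux uv -vx.
apply: eq_card => P; rewrite !inE; apply/imsetP/andP.
  by move=> [u]; rewrite inE => /andP[ut /subword_supp ux ->]; split.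
move=> [Px Pt]; exists (restrict x P); last by rewrite supp_restrict (setIidPl Px).
by rewrite inE subword_restrict andbT /wt -/(supp _) supp_restrict (setIidPl Px).
Qed.

Variables t w : nat.

Definition words : {set word} := [set x | wt x == w].

Definition traces x : {set word + {set 'I_n}} :=
  [set v : word + {set 'I_n} | match v with
           | inl u => (wt u == t) && subword u x
           | inr P => (P \subset supp x) && (#|P| == t.+1)
           end].

Lemma card_traces : {in words, forall x, #|traces x| = 'C(w, t) + 'C(w, t.+1)}.
Proof.
move=> x; rewrite inE => /eqP xw.
rewrite -{1}xw -card_subwords -xw /wt -/(supp x) -cards_draws.
rewrite -[in RHS](card_imset _ (@inl_inj word {set 'I_n})).
rewrite -[X in _ = _ + X](card_imset _ (@inr_inj word {set 'I_n})).
rewrite -cardsUI [X in _ = _ + X](_ : _ = 0) ?addn0; last first.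
  apply: eq_card0 => v; rewrite !inE; apply/negP => /andP[/imsetP[u _ ->]].
  by case/imsetP.
apply: eq_card => -[u|P]; rewrite !inE.
  by rewrite (mem_imset _ _ inl_inj) inE (introF imsetP) ?orbF // => -[].
by rewrite (mem_imset _ _ inr_inj) inE [X in X || _](introF imsetP) // => -[].
Qed.

Lemma matching_dist (x y : word) : t <= w -> wt x = w -> wt y = w -> 
  [disjoint traces x & traces y] -> (2 * (w - t)).+1 <= hdist x y.
Proof.
move=> tw xw yw dis; pose A := [set i in supp x | x i == y i].
(* Otherwise [t] common nonzero letters would give a common trace. *)
have At : #|A| < t.
  rewrite ltnNge; apply/negP => /ex_subset_card[P PA Pt].
  have Px : P \subset supp x.
    by apply: subset_trans PA _; apply/subsetP => i; rewrite inE => /andP[].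
  have := disjointFr dis (_ : inl (restrict x P) \in traces x).
  rewrite !inE /wt -/(supp _) supp_restrict (setIidPl Px) Pt eqxx subword_restrict.
  move=> /(_ isT)/negP; apply; apply/forallP => i; apply/implyP.
  rewrite supp_restrict ffunE inE => /andP[iP _]; rewrite iP.
  by have := subsetP PA i iP; rewrite inE eq_sym => /andP[].
have Ct : #|supp x :&: supp y| <= t.
  rewrite leqNgt; apply/negP => /ex_subset_card[P]; rewrite subsetI => /andP[Px Py] Pt.
  have := disjointFr dis (_ : inr P \in traces x).
  by rewrite !inE Px Py Pt eqxx => /(_ isT).
(* Where the words agree on the union of the supports, both are nonzero. *)
have : #|supp x :|: supp y| <= #|A| + hdist x y.
  apply: leq_trans (leq_card_setU _ _); apply/subset_leq_card/subsetP => i.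
  by rewrite !inE; have [->|] := eqVneq (x i) (y i); rewrite ?orbT ?orbb ?orbF ?andbT.
have : #|supp x| = w by []. have : #|supp y| = w by [].
rewrite cardsU; move: (subset_leq_card (subsetIl (supp x) (supp y))); lia.
Qed.

Lemma card_words : #|words| = 'C(n, w) * q ^ w.
Proof.
pose z : word := [ffun=> ord0].
have z0 : supp z = set0 by apply/setP => i; rewrite !inE ffunE.
have := @card_words_ext z w; rewrite z0 cards0 !subn0 => <- //.
apply: eq_card => x; rewrite !inE (_ : subword z x) ?andbT //.
by apply/forallP => i; rewrite z0 inE.
Qed.

Lemma card_words_at_inl u : t <= w ->
  #|edges_at traces words (inl u)| <= 'C(n - t, w - t) * q ^ (w - t).
Proof.
move=> tw; have [ut|ut] := eqVneq (wt u) t; last first.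
  rewrite (_ : edges_at _ _ _ = set0) ?cards0 //.
  by apply/setP => x; rewrite !inE (negPf ut) andbF.
have {}ut : #|supp u| = t by [].
have := @card_words_ext u w; rewrite ut => <- //.
by apply/subset_leq_card/subsetP => x; rewrite !inE => /andP[-> /andP[_ ->]].
Qed.

Lemma card_words_cover_succ P : t < w -> #|P| = t.+1 ->
  #|[set x : word | (wt x == w) && (P \subset supp x)]|
  <= q ^ t.+1 * ('C(n - t.+1, w - t.+1) * q ^ (w - t.+1)).
Proof. by move=> tw Pt; rewrite -Pt; apply: card_words_cover; rewrite Pt. Qed.

Lemma card_words_at_inr P : t < w ->
  #|edges_at traces words (inr P)|
  <= q ^ t.+1 * ('C(n - t.+1, w - t.+1) * q ^ (w - t.+1)).
Proof.
move=> tw; have [Pt|Pt] := eqVneq #|P| t.+1; last first.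
  rewrite (_ : edges_at _ _ _ = set0) ?cards0 //.
  by apply/setP => x; rewrite !inE (negPf Pt) !andbF.
apply: leq_trans (card_words_cover_succ tw Pt).
by apply/subset_leq_card/subsetP => x; rewrite !inE => /andP[-> /andP[->]].
Qed.

(** Distinct subwords of weight [t] of one word have distinct supports, whose union contains a set
    of [t.+1] positions. So one bound of order [D / n] serves every kind of pair. *)
Lemma card_words_at2 v v' : t < w -> v != v' ->
  #|edges_at traces words v :&: edges_at traces words v'|
  <= q ^ t.+1 * ('C(n - t.+1, w - t.+1) * q ^ (w - t.+1)).
Proof.
move=> tw; case: v => [u|P]; last first.
  by move=> _; apply: leq_trans (card_words_at_inr P tw); rewrite subset_leq_card // subsetIl.
case: v' => [u' uu'|P]; last first.
  by move=> _; apply: leq_trans (card_words_at_inr P tw); rewrite subset_leq_card // subsetIr.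
set A := _ :&: _; have [->|[x]] := set_0Vmem A; first by rewrite cards0.
rewrite !inE => /andP[/andP[_ /andP[/eqP ut ux]] /andP[_ /andP[/eqP ut' ux']]].
have [P PU Pt] : exists2 P : {set 'I_n}, P \subset supp u :|: supp u' & #|P| = t.+1.
  apply: ex_subset_card; rewrite ltnNge; apply: contraNN uu' => Ut.
  have eqU (y z : word) : wt y = t -> #|supp y :|: supp z| <= t -> supp z \subset supp y.
    move=> yt yz; have /eqP-> : supp y == supp y :|: supp z.
      by rewrite eqEcard subsetUl /= -[#|supp y|]/(wt y) yt.
    exact: subsetUr.
  have suu' : supp u = supp u'.
    by apply/eqP; rewrite eqEsubset !eqU // setUC.
  move: ux ux' => /subwordP ux /subwordP ux'.
  by rewrite (inj_eq inl_inj) ux suu' -ux'.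
apply: leq_trans (card_words_cover_succ tw Pt).
apply/subset_leq_card/subsetP => y; rewrite !inE.
move=> /andP[/andP[-> /andP[_ /subword_supp uy]] /andP[_ /andP[_ /subword_supp u'y]]].
by apply: subset_trans PU _; rewrite subUset uy.
Qed.

Lemma matching_code (M : {set word}) :
  t <= w -> M \subset words -> is_matching traces M ->
  #|M| <= Aq q.+1 n (2 * (w - t)).+1 w.
Proof.
move=> tw Mw /is_matchingP MM; apply: (@leq_bigmax_cond _ _ (fun C : {set word} => #|C|)).
have wtM x : x \in M -> wt x = w by move=> /(subsetP Mw); rewrite inE => /eqP.
apply/andP; split; first by apply/forall_inP => x /wtM/eqP.
apply/forall_inP => x xM; apply/forall_inP => y yM; apply/implyP => xy.
by apply: matching_dist; rewrite ?wtM ?MM.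
Qed.

End Words.

(** Both sides count [t]-sets inside [w]-sets of an [n]-set. *)
Lemma bin_mul_bin n w t : t <= w -> w <= n ->
  'C(n, w) * 'C(w, t) = 'C(n, t) * 'C(n - t, w - t).
Proof.
move=> tw wn; have := bin_fact wn; have := bin_fact tw.
have := bin_fact (leq_trans tw wn); have := bin_fact (leq_sub2r t wn).
rewrite subnBA // subnK ?(leq_trans tw wn) // => E1 E2 E3 E4; apply/eqP.
rewrite -(eqn_pmul2r (_ : 0 < t`! * (w - t)`! * (n - w)`!)) ?muln_gt0 ?fact_gt0 //.
rewrite (_ : _ * _ =
  'C(n, w) * (('C(w, t) * (t`! * (w - t)`!)) * (n - w)`!)); last by ring.
rewrite (_ : 'C(n, t) * _ * _ =
  'C(n, t) * (t`! * ('C(n - t, w - t) * ((w - t)`! * (n - w)`!)))); last by ring.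
by rewrite E1 E2 E3 E4.
Qed.

(** * The lower bound for large [n] *)

Section Asymptotics.
Local Open Scope ring_scope.
Variable R : archiRealFieldType.

(** This settles [t = w], where [D = 1] does not grow with [n]. *)
Lemma Aq_ge_words q n w : (#|words q n w| <= Aq q.+1 n 1 w)%N.
Proof.
apply: (@leq_bigmax_cond _ _ (fun C : {set word q.+1 n} => #|C|)).
apply/andP; split; first by apply/forall_inP => x; rewrite inE.
apply/forall_inP => x _; apply/forall_inP => y _; apply/implyP => xy.
apply/card_gt0P; move: xy; case: (pickP (fun i => x i != y i)) => [i xyi _|eqxy].
  by exists i; rewrite inE.
by move=> /eqP[]; apply/ffunP => i; have /negbFE/eqP := eqxy i.
Qed.

Lemma card_words_ratio q n t w : (0 < q)%N -> (t <= w)%N -> (w <= n)%N ->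
  q%:R ^+ t * 'C(n, t)%:R / 'C(w, t)%:R
  = #|words q n w|%:R / ('C(n - t, w - t) * q ^ (w - t))%:R :> R.
Proof.
move=> q0 tw wn; apply/eqP; rewrite eqr_div ?pnatr_eq0 -?lt0n ?muln_gt0 ?bin_gt0 //;
  last by rewrite expn_gt0 q0 leq_sub2r.
rewrite -natrX -!natrM eqr_nat card_words [X in _ == X]mulnAC bin_mul_bin //.
have -> : (q ^ w = q ^ t * q ^ (w - t))%N by rewrite -expnD subnKC.
by apply/eqP; ring.
Qed.

Lemma Aq_asymptotic q w t (eps : R) : (0 < q)%N -> (t <= w)%N -> 0 < eps ->
  exists N, forall n, (N <= n)%N ->
    (1 - eps) * (q%:R ^+ t * 'C(n, t)%:R / 'C(w, t)%:R)
    <= (Aq q.+1 n (2 * (w - t)).+1 w)%:R.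
Proof.
move=> q0 tw e0; have [tw'|wt] := ltnP t w; last first.
  have -> : t = w by apply/eqP; rewrite eqn_leq tw.
  exists w => n wn; rewrite card_words_ratio // subnn bin0 divr1.
  apply: le_trans (_ : #|words q n w|%:R <= _); last by rewrite ler_nat Aq_ge_words.
  by rewrite ler_piMl // gerBl ltW.
have [|delta delta0 pack] := @packable_lt1 R ('C(w, t) + 'C(w, t.+1)) eps _ e0.
  by rewrite addn_gt0 bin_gt0 tw.
(* The cap at 1 yields [B <= D], so the vertices that are sets respect the degree bound as well. *)
pose delta' := Num.min delta 1.
have delta'0 : 0 < delta' by rewrite lt_min delta0 ltr01.
(* Absorption of binomials gives [(n - t) * B <= q ^ t.+1 * w * D], so [n - t >= K] suffices. *)
pose K := (q ^ t.+1 * w)%:R / delta'.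
exists (maxn w (t + Num.bound K)) => n; rewrite geq_max => /andP[wn Kn].
set D := ('C(n - t, w - t) * q ^ (w - t))%N.
pose B := (q ^ t.+1 * ('C(n - t.+1, w - t.+1) * q ^ (w - t.+1)))%N.
have BD : B%:R <= delta' * D%:R.
  have nt0 : (0 < n - t)%N by rewrite subn_gt0 (leq_trans tw').
  rewrite -(ler_pM2l (_ : 0 < (n - t)%:R)) ?ltr0n //.
  apply: le_trans (_ : (q ^ t.+1 * w)%:R * D%:R <= _).
    rewrite -!natrM ler_nat /B /D.
    have diag : ((n - t) * 'C(n - t.+1, w - t.+1) = (w - t) * 'C(n - t, w - t))%N.
      by rewrite -[in RHS](subnSK tw') -mul_bin_diag subnS.
    have qS : (q ^ (w - t) = q * q ^ (w - t.+1))%N by rewrite -expnS subnSK.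
    rewrite qS; move: diag (leq_subr t w) q0.
    move: (n - t)%N (w - t)%N (q ^ t.+1)%N (q ^ (w - t.+1))%N
      'C(n - t.+1, w - t.+1) 'C(n - t, w - t) => m r a z c1 c2 diag rw q0.
    rewrite (_ : m * (a * (c1 * z)) = a * z * (m * c1))%N; last by ring.
    rewrite diag (_ : a * w * (c2 * (q * z)) = a * z * (w * q * c2))%N; last by ring.
    rewrite leq_mul2l leq_mul2r; apply/orP; right; apply/orP; right.
    by apply: leq_trans rw _; rewrite leq_pmulr.
  rewrite mulrCA mulrA ler_wpM2r // mulrC -ler_pdivrMr // -/K.
  apply: le_trans (ltW (archi_boundP _)) _; first by rewrite divr_ge0 // ltW.
  by rewrite ler_nat leq_subRL //; apply: leq_trans wn.
have BdD : B%:R <= delta * D%:R.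
  by apply: le_trans BD _; rewrite ler_wpM2r // ge_min lexx.
have BD1 : (B <= D)%N.
  by rewrite -(ler_nat R); apply: le_trans BD _; rewrite ler_piMl // ge_min lexx orbT.
(* With [B <= delta * D] this also gives the required [1 <= delta * D]. *)
have B1 : (0 < B)%N.
  by rewrite !muln_gt0 !expn_gt0 q0 bin_gt0 leq_sub2r.
have := pack _ _ (traces t) (words q n w) D (@card_traces q n t w).
have [M [ME MM ->]] := nu_witness (@traces q n t) (words q n w).
move=> /(_ _ _ _)/le_trans packM.
rewrite card_words_ratio // -/D mulrA ler_pdivrMr ?ltr0n; last exact: leq_trans BD1.
apply: packM.
- move=> [u|P]; first exact: card_words_at_inl.
  by apply: leq_trans BD1; apply: card_words_at_inr.
- by move=> u v uv; apply: le_trans BdD; rewrite ler_nat; apply: card_words_at2.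
- by apply: le_trans BdD; rewrite ler1n.
- by rewrite mulrC ler_wpM2r // ler_nat matching_code.
Qed.

End Asymptotics.

(* Required only here: [classical_sets] shadows the lemma names of [finset]. *)
From mathcomp Require Import all_classical all_reals all_analysis.
Import numFieldNormedType.Exports.
Local Open Scope classical_set_scope.
Local Open Scope ring_scope.

Theorem theorem1p4 (R : realType) (q w d t : nat)
  (hq : (0 < q)%N) (hw : (0 < w)%N) (hd : (0 < d)%N) (hodd : odd d)
  (ht : t%:R = (2 * w%:R - d%:R + 1) / 2 :> R)
  (hdeg : (1 < q)%N \/ (0 < t)%N) :
  exists eps : nat -> R,
    (eps n @[n --> \oo] --> (0 : R)) /\
    (\forall n \near \oo,
       (1 - eps n) * ((q%:R - 1) ^+ t * 'C(n, t)%:R / 'C(w, t)%:R)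
       <= (Aq q n d w)%:R).
Proof.
(* [ht] lives in [R], so no truncated subtraction or division interferes. *)
have td : (2 * t + d = 2 * w + 1)%N.
  apply/eqP; rewrite -(eqr_nat R) natrD natrM [X in _ == X]natrD natrM ht.
  by apply/eqP; field.
have tw : (t <= w)%N by lia.
have -> : d = (2 * (w - t)).+1 by lia.
case: q hq hdeg => // q _ hdeg; rewrite -natr1 addrK.
(* With a single letter, [hdeg] forces [t > 0], so [0 ^+ t] is 0 rather than 1 and the bound
   vanishes. *)
case: (posnP q) => [q0|q0].
  exists (fun=> 0); split; first exact: cvg_cst.
  near=> n; rewrite q0 expr0n; case: hdeg; rewrite ?q0 // lt0n => /negPf->.
  by rewrite !mul0r mulr0.
pose T n : R := q%:R ^+ t * 'C(n, t)%:R / 'C(w, t)%:R.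
have T0 n : (t <= n)%N -> 0 < T n.
  by move=> tn; rewrite divr_gt0 ?mulr_gt0 ?exprn_gt0 ?ltr0n ?bin_gt0.
(* The relative deficit, cut off at 0: the inequality then holds by construction once [T n > 0], and
   convergence needs only an upper bound. *)
exists (fun n => Num.max 0 (1 - (Aq q.+1 n (2 * (w - t)).+1 w)%:R / T n)); split.
  apply/cvgrPdist_le => e e0; have [N HN] := Aq_asymptotic q0 tw e0.
  near=> n; rewrite sub0r normrN ger0_norm ?le_max ?lexx //.
  rewrite ge_max (ltW e0) lerBlDr -lerBlDl ler_pdivlMr; last first.
    by apply: T0; near: n; exact: nbhs_infty_ge.
  by apply: HN; near: n; exact: nbhs_infty_ge.
near=> n; rewrite -/(T n) -ler_pdivlMr; last first.
  by apply: T0; near: n; exact: nbhs_infty_ge.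
by rewrite lerBlDr -lerBlDl le_max lexx orbT.
Unshelve. all: by end_near.
Qed.
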